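(* Let $(X,d,\delta)$ be a dilatation structure. Then the ''infinitesimal translations'' $L^x_u(v)=\lim_{\varepsilon\to0}\Delta^x_\varepsilon(u,v)$, where $\Delta^x_\varepsilon(u,v)=\delta_{\varepsilon^{-1}}^{\delta^x_\varepsilon u}\,\delta^x_\varepsilon v$, are $d^x$-isometries; that is, for every $x\in X$ and all $u,v,w$ sufficiently close to $x$, $$d^x\big(L^x_u(v),L^x_u(w)\big)=d^x(v,w).$$
   Context: **Parameters.** $\Gamma$ is a Hausdorff topological commutative group, written multiplicatively with neutral element $1$, with a continuous group morphism $\nu:\Gamma\to(0,+\infty)$ (multiplicative group) such that $\inf\nu(\Gamma)=0$; the basic case is $\Gamma=(0,+\infty)$, $\nu=\mathrm{id}$. $\Gamma_1=\nu^{-1}((0,1])$. ''$\varepsilon\to0$'' means $\nu(\varepsilon)\to0$; an element $0$ is adjoined to $\Gamma$ with neighbourhoods generated by $\nu^{-1}((0,a))\cup\{0\}$, $a>0$. $\mathcal O(\varepsilon)$ denotes a positive function tending to $0$ as $\varepsilon\to0$. **Dilatation structure.** $(X,d)$ is a complete, locally compact metric space (small balls are compact); $B_d(x,r)$, $\bar B_d(x,r)$ are open and closed balls. $(X,d,\delta)$ is a dilatation structure if: A0. There are constants $A>1$ and $B$. For $\varepsilon\in\Gamma_1$, $x\in X$, the dilatation $\delta^x_\varepsilon:U(x)\to V_\varepsilon(x)$ is a homeomorphism, $\bar B_d(x,A)\subset U(x)$, and for $\nu(\varepsilon)<1$: $B_d(x,\nu(\varepsilon))\subset\delta^x_\varepsilon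 B_d(x,A)\subset V_\varepsilon(x)\subset U(x)$. For $\nu(\varepsilon)>1$, $\delta^x_\varepsilon:W_\varepsilon(x)\to B_d(x,B)$ is injective, continuous, with continuous inverse on its image, $W_\varepsilon(x)$ is open, $V_{\varepsilon^{-1}}(x)\subset W_\varepsilon(x)$, and $\delta^x_{\varepsilon^{-1}}\delta^x_\varepsilon u=u$ for $\varepsilon\in\Gamma_1$, $u\in U(x)$. Moreover for any compact $K\subset X$ there are $R=R(K)>0$ and $\varepsilon_0=\varepsilon_0(K)\in(0,1)$ such that for all $x\in K$, $u,v\in\bar B_d(x,R)$ and $\nu(\varepsilon)\in(0,\varepsilon_0)$: $\delta^x_\varepsilon v\in W_{\varepsilon^{-1}}(\delta^x_\varepsilon u)$. A1. $\delta^x_1=\mathrm{id}$; $\frac1{\nu(\varepsilon)}d(x,\delta^x_\varepsilon x)\to0$ as $\varepsilon\to0$, uniformly for $x$ in compact sets (strong form: $\delta^x_\varepsilon x=x$); the map $(\varepsilon,x,y)\mapsto\delta^x_\varepsilon y$ is continuous on $\mathrm{dom}\,\delta=\{(\varepsilon,x,y)\in\Gamma\times X\times X: y\in U(x)\text{ if }\nu(\varepsilon)\le1,\ y\in W_\varepsilon(x)\text{ otherwise}\}$ and extends continuously to the closure of $\mathrm{dom}\,\delta$ in $(\Gamma\cup\{0\})\times X\times X$, with $\lim_{\varepsilon\to0}\delta^x_\varepsilon y=x$. A2. For any compact $K$, $x\in K$, $\nu(\varepsilon),\nu(\mu)\in(0,1)$, $u,v\in\bar B_d(x,A)$: $\frac{1}{\nu(\varepsilon\mu)}|d(\delta^x_\varepsilon\delta^x_\mu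 u,\delta^x_\varepsilon\delta^x_\mu v)-d(\delta^x_{\varepsilon\mu}u,\delta^x_{\varepsilon\mu}v)|\le\mathcal O(\varepsilon\mu)$ (strong form: $\delta^x_\varepsilon\delta^x_\mu u=\delta^x_{\varepsilon\mu}u$). A3. For any $x$ there is a function $(u,v)\mapsto d^x(u,v)$ on $\bar B_d(x,A)^2$ with $\lim_{\varepsilon\to0}\sup\{|\frac1{\nu(\varepsilon)}d(\delta^x_\varepsilon u,\delta^x_\varepsilon v)-d^x(u,v)|:u,v\in\bar B_d(x,A)\}=0$, uniformly for $x$ in compact sets; and $d^x$ is non-degenerate ($d^x(u,v)=0\Rightarrow u=v$). A4. With $\Delta^x_\varepsilon(u,v)=\delta_{\varepsilon^{-1}}^{\delta^x_\varepsilon u}\delta^x_\varepsilon v$, the limit $\lim_{\varepsilon\to0}\Delta^x_\varepsilon(u,v)=\Delta^x(u,v)$ exists uniformly with respect to $x,u,v$ in compact sets. *)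

(* Defs.v *)
From HB Require Import structures.
From mathcomp Require Import all_boot all_order all_algebra.
From mathcomp Require Import all_classical all_reals all_analysis.

Set Implicit Arguments.
Unset Strict Implicit.
Unset Printing Implicit Defensive.

Import Order.TTheory GRing.Theory Num.Theory.
Import numFieldTopology.Exports.

Local Open Scope classical_set_scope.
Local Open Scope ring_scope.

HB.mixin Record isHausdorffCommTopGroup G of Topological G & Group G := {
  mulg_comm : forall x y : G, (x * y = y * x)%g;
  mulg_continuous : continuous (fun p : G * G => (p.1 * p.2)%g);
  invg_continuous : continuous (fun x : G => (x^-1)%g);
  topgroup_hausdorff : hausdorff_space G
}.

#[short(type="hausdorffCommTopGroupType")]
HB.structure Definition HausdorffCommTopGroup :=
  {G of Topological G & Group G & isHausdorffCommTopGroup G}.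

(* Completeness is the library's [Complete], which also provides a point of
   the space: this is what makes [lim] available. *)
#[short(type="completeMetricType")]
HB.structure Definition CompleteMetric (R : numDomainType) :=
  {T of Metric R T & Complete T}.

Record is_scale (R : realType) (G : hausdorffCommTopGroupType) (nu : G -> R) :
    Prop := {
  scale_gt0 : forall e, 0 < nu e;
  scaleM : forall e m, nu (e * m)%g = nu e * nu m;
  scale_continuous : continuous nu;
  scale_inf : inf (range nu) = 0
}.

(* The filter "epsilon -> 0", that is "nu epsilon -> 0". *)
Definition to0 (R : realType) (G : Type) (nu : G -> R) : set_system G :=
  filter_from [set a : R | 0 < a] (fun a => [set e | 0 < nu e < a]).

(* [adjoin0 nu] is the space obtained by adjoining to G an element 0 (here
   [None]): the topology of G is kept on G, and a neighbourhood of 0 contains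
   {0} together with some nu^-1(]0, a[), a > 0. *)
Definition adjoin0 (R : realType) (G : topologicalType) (nu : G -> R) : Type :=
  option G.

Section adjoin0_topology.
Context {R : realType} {G : topologicalType} {nu : G -> R}.
Implicit Types S T : set (adjoin0 nu).

HB.instance Definition _ := Choice.on (adjoin0 nu).

Definition adjoin0_open : set_system (adjoin0 nu) :=
  [set S : set (adjoin0 nu) |
    open [set e : G | S (Some e)] /\
    (S None -> to0 nu [set e : G | S (Some e)])].

Let adjoin0_openT : adjoin0_open setT.
Proof. by split; [exact: openT | move=> _; exists 1 => //=; exact: ltr01]. Qed.

Let adjoin0_openI : setI_closed adjoin0_open.
Proof.
move=> S T [oS S0] [oT T0]; split; first exact: openI.
move=> [/S0[a /= a0 aS] /T0[b /= b0 bT]]; exists (Num.min a b).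
  by rewrite /= lt_min a0 b0.
by move=> e /= /andP[e0]; rewrite lt_min => /andP[ea eb];
  split; [apply: aS|apply: bT]; rewrite /= e0.
Qed.

Let adjoin0_open_bigU (I : Type) (f : I -> set (adjoin0 nu)) :
  (forall i, adjoin0_open (f i)) -> adjoin0_open (\bigcup_i f i).
Proof.
move=> fo; split.
  have -> : [set e : G | (\bigcup_i f i) (Some e)] =
            \bigcup_i [set e : G | f i (Some e)] by [].
  by apply: bigcup_open => i _; exact: (fo i).1.
move=> [i _ fi0]; have [a a0 aS] := (fo i).2 fi0.
by exists a => // e /aS fie; exists i.
Qed.

HB.instance Definition _ := isOpenTopological.Build (adjoin0 nu)
  adjoin0_openT adjoin0_openI adjoin0_open_bigU.

End adjoin0_topology.

(* Not the library's [closed_ball], which is the closure of the open ball. *)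
Definition cball (R : realType) (X : metricType R) (x : X) (r : R) : set X :=
  [set y | mdist x y <= r].

Definition homeo_between (X Y : topologicalType) (f : X -> Y)
    (S : set X) (T : set Y) : Prop :=
  [/\ set_bij S T f, {within S, continuous f} &
      exists2 g : Y -> X, {within T, continuous g} & {in S, cancel f g}].

Section dilatations.
Context {R : realType} {G : hausdorffCommTopGroupType} {X : completeMetricType R}.
Variables (nu : G -> R) (U : X -> set X) (V W : G -> X -> set X).

(* A dilatation [delta^x_e] is a partial map; [dil e x] is a total function
   whose values matter only on the domain [U x] if [nu e <= 1], [W e x]
   otherwise.  Likewise [dx x], which stands for [d^x], matters only on
   [cball x A]. *)
Variables (dil : G -> X -> X -> X) (dx : X -> X -> X -> R).

Definition dil_dom : set (G * X * X) :=
  [set p | if nu p.1.1 <= 1 then U p.1.2 p.2 else W p.1.1 p.1.2 p.2].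

Definition dil_dom0 : set (adjoin0 nu * X * X) :=
  [set (Some p.1.1 : adjoin0 nu, p.1.2, p.2) | p in dil_dom].

Definition Delta (e : G) (x u v : X) : X :=
  dil (e^-1)%g (dil e x u) (dil e x v).

Definition Delta_defined (e : G) (x u v : X) : Prop :=
  [/\ U x u, U x v & W (e^-1)%g (dil e x u) (dil e x v)].

Record axiom0 (A B : R) : Prop := {
  ax0_gt1 : 1 < A;
  ax0_homeo : forall e x, nu e <= 1 -> homeo_between (dil e x) (U x) (V e x);
  ax0_cball : forall x, cball x A `<=` U x;
  ax0_lt1 : forall e x, nu e < 1 ->
    [/\ ball x (nu e) `<=` dil e x @` ball x A,
        dil e x @` ball x A `<=` V e x & V e x `<=` U x];
  ax0_gt1_homeo : forall e x, 1 < nu e ->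
    dil e x @` W e x `<=` ball x B /\
    homeo_between (dil e x) (W e x) (dil e x @` W e x);
  ax0_gt1_dom : forall e x, 1 < nu e ->
    open (W e x) /\ V (e^-1)%g x `<=` W e x;
  ax0_cancel : forall e x u, nu e <= 1 -> U x u ->
    dil (e^-1)%g x (dil e x u) = u;
  ax0_compact : forall K : set X, compact K ->
    exists r e0 : R, [/\ 0 < r, 0 < e0 < 1 &
      forall x u v e, K x -> cball x r u -> cball x r v -> 0 < nu e < e0 ->
        W (e^-1)%g (dil e x u) (dil e x v)]
}.

Record axiom1 : Prop := {
  ax1_id : forall x u, U x u -> dil 1%g x u = u;
  ax1_base : forall K : set X, compact K ->
    {uniform K, (fun e x => (nu e)^-1 * mdist x (dil e x x)) @ to0 nu -->
                (fun=> 0 : R)};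
  ax1_continuous :
    {within dil_dom, continuous (fun p => dil p.1.1 p.1.2 p.2)};
  ax1_extend : exists2 f : adjoin0 nu * X * X -> X,
    {within closure dil_dom0, continuous f} &
    forall e x y, dil_dom (e, x, y) -> f (Some e, x, y) = dil e x y;
  ax1_lim0 : forall x y, U x y -> dil e x y @[e --> to0 nu] --> x
}.

Definition axiom2 (A : R) : Prop :=
  forall K : set X, compact K ->
  exists O : G -> R, [/\ forall e, 0 < O e, O e @[e --> to0 nu] --> 0 &
    forall x u v e m, K x -> 0 < nu e < 1 -> 0 < nu m < 1 ->
      cball x A u -> cball x A v ->
      (nu (e * m)%g)^-1 *
        `|mdist (dil e x (dil m x u)) (dil e x (dil m x v)) -
          mdist (dil (e * m)%g x u) (dil (e * m)%g x v)| <= O (e * m)%g].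

Record axiom3 (A : R) : Prop := {
  ax3_lim : forall K : set X, compact K -> forall eta : R, 0 < eta ->
    \forall e \near to0 nu, forall x, K x ->
      (ereal_sup
        [set `|(nu e)^-1 * mdist (dil e x u) (dil e x v) - dx x u v|%:E
          | u in cball x A & v in cball x A] <= eta%:E)%E;
  ax3_nondegenerate : forall x u v, cball x A u -> cball x A v ->
    dx x u v = 0 -> u = v
}.

(* "Compact sets" are those on which [Delta e] is defined for all small
   [e]; by the last clause of [axiom0] these include the compact sets of
   triples (x, u, v) with x in a compact K and u, v in [cball x r], r small. *)
Definition axiom4 : Prop :=
  exists L : X * X * X -> X, forall C : set (X * X * X), compact C ->
    (\forall e \near to0 nu, forall p, C p ->
       Delta_defined e p.1.1 p.1.2 p.2) ->
    {uniform C, (fun e p => Delta e p.1.1 p.1.2 p.2) @ to0 nu --> L}.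

Record dilatation_structure (A B : R) : Prop := {
  dil_scale : is_scale nu;
  dil_locally_compact : locally_compact [set: X];
  dil_axiom0 : axiom0 A B;
  dil_axiom1 : axiom1;
  dil_axiom2 : axiom2 A;
  dil_axiom3 : axiom3 A;
  dil_axiom4 : axiom4
}.

Definition inf_translation (x u v : X) : X :=
  lim (Delta e x u v @[e --> to0 nu]).

End dilatations.

(* Main.v *)
(* Put y_e = delta^x_e u, which tends to x, and z_e = Delta^x_e(u, v).  When
   d^x(u, v) < 1, which holds for u, v close to x, the point delta^x_e v lies
   in the ball of centre y_e and radius nu e, hence it is delta^(y_e)_e z for
   some z within A of y_e, and cancellation gives z = z_e.  So the rescaled
   distance of delta^x_e v and delta^x_e w is close to d^x(v, w) by A3 at x,
   and close to d^(y_e)(Delta^x_e(u, v), Delta^x_e(u, w)) by A3 at y_e, which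
   is uniform in the base point.  The latter tends to d^x(L v, L w) since d^x,
   a uniform limit of continuous functions, is jointly continuous. *)
Require Import Defs.
From mathcomp Require Import all_boot all_order all_algebra.
From mathcomp Require Import all_classical all_reals all_analysis.
From mathcomp Require Import lra.

Import Order.TTheory GRing.Theory Num.Theory.
Import numFieldTopology.Exports numFieldNormedType.Exports.

Local Open Scope classical_set_scope.
Local Open Scope ring_scope.

Set Implicit Arguments.
Unset Strict Implicit.
Unset Printing Implicit Defensive.

Lemma mdist_cvg (R : realType) (X : metricType R) (T : Type)
    (F : set_system T) {FF : Filter F} (f g : T -> X) (a b : X) :
  f @ F --> a -> g @ F --> b -> mdist (f t) (g t) @[t --> F] --> mdist a b.
Proof.
move=> fa gb; apply/cvgrPdist_lt => eta eta0.
have eta2 : 0 < eta / 2 by rewrite divr_gt0.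
have /(_ FF){}fa := metricType_numDomainType.cvgr_dist_lt fa eta2.
have /(_ FF){}gb := metricType_numDomainType.cvgr_dist_lt gb eta2.
near=> t.
have ft : mdist a (f t) < eta / 2 by near: t.
have gt : mdist b (g t) < eta / 2 by near: t.
have := metric_triangle (f t) a (g t); have := metric_triangle a b (g t).
have := metric_triangle a (f t) b; have := metric_triangle (f t) (g t) b.
rewrite (metric_sym (f t) a) (metric_sym (g t) b) => h1 h2 h3 h4.
rewrite ltr_norml; lra.
Unshelve. all: by end_near. Qed.

Section scale.
Context {R : realType} {G : hausdorffCommTopGroupType} (nu : G -> R).
Hypothesis nuP : is_scale nu.

(** Properness comes from [inf (range nu) = 0]: some scale lies within [a] of the infimum, so no
    basic set is empty. *)
Lemma to0_proper_filter : ProperFilter (to0 nu).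
Proof.
apply: filter_from_proper; last first.
  move=> a /= a0.
  have nuI : has_inf (range nu).
    split; first by exists (nu 1%g), 1%g.
    by exists 0 => _ [e _ <-]; exact/ltW/scale_gt0.
  have [_ [e _ <-]] := inf_adherent a0 nuI.
  by rewrite (scale_inf nuP) add0r => ea; exists e; rewrite /= (scale_gt0 nuP).
apply: filter_from_filter; first by exists 1; rewrite /= ltr01.
move=> a b /= a0 b0; exists (Num.min a b); first by rewrite /= lt_min a0.
by move=> e /= /andP[-> ]; rewrite lt_min => /andP[-> ->].
Qed.

Lemma near_to0_lt (a : R) : 0 < a -> \forall e \near to0 nu, nu e < a.
Proof. by move=> a0; exists a => //= e /andP[]. Qed.

End scale.

Section dilatation_structure.
Context {R : realType} {G : hausdorffCommTopGroupType} {X : completeMetricType R}.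
Context (nu : G -> R) (A B : R) (U : X -> set X) (V W : G -> X -> set X).
Context (dil : G -> X -> X -> X) (dx : X -> X -> X -> R).
Hypothesis Hdil : dilatation_structure nu U V W dil dx A B.

Let nuP := dil_scale Hdil.
Let ax0 := dil_axiom0 Hdil.
Let ax1 := dil_axiom1 Hdil.

Local Instance to0P : ProperFilter (to0 nu) := to0_proper_filter nuP.

Let nu_gt0 e : 0 < nu e. Proof. exact: scale_gt0. Qed.

Let A_gt0 : 0 < A. Proof. exact: lt_trans ltr01 (ax0_gt1 ax0). Qed.

Lemma compact_nbhs (x : X) : exists2 K, nbhs x K & compact K.
Proof.
have [K KxT [cK _]] := dil_locally_compact Hdil (I : [set: X] x).
by exists K => //; apply: (filterS (fun y => @^~ I) KxT).
Qed.

Lemma cball_center (x : X) : cball x A x.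
Proof. by rewrite /cball /= mdistxx ltW. Qed.

Lemma ball_cball (x y : X) : ball x A y -> cball x A y.
Proof. by rewrite ballEmdist => /ltW. Qed.

(** At a fixed scale [nu m <= 1] the condition [dil_dom] reduces to [U], so the joint continuity in
    A1 applies along any filter that eventually stays in this domain. *)
Lemma dil_cvg (T : Type) (F : set_system T) {FF : Filter F}
    (m : G) (x a : X) (f g : T -> X) :
  nu m <= 1 -> U x a -> f @ F --> x -> g @ F --> a ->
  (\forall t \near F, U (f t) (g t)) ->
  dil m (f t) (g t) @[t --> F] --> dil m x a.
Proof.
move=> m1 Uxa fx ga Ufg.
have /subspace_continuousP/(_ (m, x, a)) := ax1_continuous ax1.
rewrite /dil_dom /= m1 => /(_ Uxa) dilC.
have mfg : (m, f t, g t) @[t --> F] --> (m, x, a).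
  exact: (cvg_pair (cvg_pair (cvg_cst m) fx) ga).
move=> P /dilC/mfg; apply: filterS2 Ufg => t /= Ut; apply.
by rewrite /= m1.
Qed.

Lemma near_dx (K : set X) (eta : R) : compact K -> 0 < eta ->
  \forall e \near to0 nu, forall y u v, K y -> cball y A u -> cball y A v ->
    `|(nu e)^-1 * mdist (dil e y u) (dil e y v) - dx y u v| <= eta.
Proof.
move=> cK eta0; have := ax3_lim (dil_axiom3 Hdil) cK eta0.
apply: filterS => e supe y u v Ky yu yv.
rewrite -lee_fin; apply: le_trans (supe y Ky).
by apply: ereal_sup_ubound; exists u => //; exists v.
Qed.

Lemma rescaled_dist_cvg (x u v : X) : cball x A u -> cball x A v ->
  (nu e)^-1 * mdist (dil e x u) (dil e x v) @[e --> to0 nu] --> dx x u v.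
Proof.
move=> xu xv; apply/cvgrPdist_le => eta eta0.
have := near_dx (@compact_set1 _ x) eta0.
by apply: filterS => e dxe; rewrite distrC; exact: dxe.
Qed.

(** This is joint continuity of [dx], base point included, by an [eta / 3] argument. The compact
    neighbourhood [K] of [x] makes the approximation in A3 uniform over the moving base points
    [f t]. *)
Lemma dx_cvg (T : Type) (F : set_system T) {FF : Filter F} (x a b : X)
    (f g h : T -> X) :
  f @ F --> x -> g @ F --> a -> h @ F --> b -> cball x A a -> cball x A b ->
  (\forall t \near F, cball (f t) A (g t) /\ cball (f t) A (h t)) ->
  dx (f t) (g t) (h t) @[t --> F] --> dx x a b.
Proof.
move=> fx ga hb xa xb fgh; apply/cvgrPdist_lt => eta eta0.
have eta3 : 0 < eta / 3 by rewrite divr_gt0.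
have [K xK cK] := compact_nbhs x.
have Kx := nbhs_singleton xK.
(* One scale [m] is frozen here, so that what remains is the continuity of a single rescaled
   distance. *)
have [m [dm m1]] : exists m, (forall y u v, K y -> cball y A u -> cball y A v ->
    `|(nu m)^-1 * mdist (dil m y u) (dil m y v) - dx y u v| <= eta / 3) /\
    nu m < 1.
  apply: (@filter_ex _ (to0 nu)).
  by apply: filterI; [exact: near_dx | exact: near_to0_lt].
have subU := ax0_cball ax0.
have dmt : (nu m)^-1 * mdist (dil m (f t) (g t)) (dil m (f t) (h t)) @[t --> F]
    --> (nu m)^-1 * mdist (dil m x a) (dil m x b).
  apply: cvgMr; apply: mdist_cvg; apply: dil_cvg => //; rewrite ?ltW//;
    try exact: subU;
    by apply: filterS fgh => t [? ?]; exact: subU.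
have {}dmt := @cvgr_dist_lt _ _ _ _ FF _ _ dmt _ eta3.
have Kf := fx K xK.
near=> t.
have [ft gt] : cball (f t) A (g t) /\ cball (f t) A (h t) by near: t.
have Kft : K (f t) by near: t.
have := dm _ _ _ Kft ft gt; have := dm _ _ _ Kx xa xb.
have : `|(nu m)^-1 * mdist (dil m x a) (dil m x b) -
  (nu m)^-1 * mdist (dil m (f t) (g t)) (dil m (f t) (h t))| < eta / 3.
  by near: t.
rewrite !ler_norml !ltr_norml; lra.
Unshelve. all: by end_near. Qed.

Lemma dx_center (x : X) : dx x x x = 0.
Proof.
have := rescaled_dist_cvg (cball_center x) (cball_center x).
under eq_cvg do rewrite mdistxx mulr0.
by move=> /(cvg_unique _ (cvg_cst 0)) ->.
Qed.

(** [dx x] is continuous at [(x, x)] and vanishes there. The bound 1 is the threshold that puts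
    [dil e x v] within [nu e] of [dil e x u] for small [e]. *)
Lemma dx_lt1 (x : X) :
  exists2 r, 0 < r & forall u v, ball x r u -> ball x r v -> dx x u v < 1.
Proof.
have xA : nbhs x (cball x A).
  by apply/nbhs_ballP; exists A => //= y /ball_cball.
have : dx x p.1 p.2 @[p --> (x, x)] --> dx x x x.
  apply: dx_cvg; try exact: cball_center; try exact: cvg_cst.
  - exact: cvg_fst.
  - exact: cvg_snd.
  - by exists (cball x A, cball x A).
rewrite dx_center => /cvgrPdist_lt/(_ 1 ltr01)/nbhs_ballP[r r0 xr].
exists r => // u v xu xv; have /= := xr (u, v) (conj xu xv).
by rewrite sub0r normrN => /(le_lt_trans (ler_norm _)).
Qed.

(** The first conjunct places [Delta] where A3 at the base point [dil e x u] controls [dx]; the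
    second identifies the dilated points whose distance A3 then measures. *)
Lemma near_DeltaK (x u v : X) :
  cball x A u -> cball x A v -> dx x u v < 1 ->
  \forall e \near to0 nu,
    ball (dil e x u) A (Delta dil e x u v) /\
    dil e (dil e x u) (Delta dil e x u v) = dil e x v.
Proof.
move=> xu xv uv1.
have uv_lt1 : \forall e \near to0 nu,
    (nu e)^-1 * mdist (dil e x u) (dil e x v) < 1.
  exact: (cvgr_lt _ (rescaled_dist_cvg xu xv) _ uv1).
near=> e.
have e1 : nu e < 1 by near: e; exact: near_to0_lt.
have euv : ball (dil e x u) (nu e) (dil e x v).
  rewrite ballEmdist /= -[ltRHS]mulr1 -ltr_pdivrMl//.
  by near: e.
(* A0 is used at the moved base point [dil e x u], not at [x]. *)
have [+ _ _] := ax0_lt1 ax0 (dil e x u) e1 => /(_ _ euv)[z yz zE].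
rewrite /Delta -zE (ax0_cancel ax0) ?(ltW e1)//.
exact/(ax0_cball ax0)/ball_cball.
Unshelve. all: by end_near. Qed.

(** Pointwise convergence suffices, so A4 is applied to the singleton of [(x, u, v)]. The last
    clause of A0 supplies the required definedness near [x]. Convergence guarantees that the [lim]
    in [inf_translation] is a true limit and not a default value. *)
Lemma Delta_cvg (x : X) : exists2 r, 0 < r &
  forall u v, ball x r u -> ball x r v ->
    Delta dil e x u v @[e --> to0 nu] --> inf_translation nu dil x u v.
Proof.
have [r [e0 [r0 /andP[e00 _] xW]]] := ax0_compact ax0 (@compact_set1 _ x).
have [L LP] := dil_axiom4 Hdil.
exists (Num.min r A) => [|u v]; first by rewrite lt_min r0.
have minP y : ball x (Num.min r A) y -> cball x r y /\ U x y.
  move=> xy; have : mdist x y < Num.min r A by move: xy; rewrite ballEmdist.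
  rewrite lt_min => /andP[/ltW xr /ltW xA].
  by split=> //; exact: (ax0_cball ax0).
move=> /minP[xu Uu] /minP[xv Uv].
have Def : \forall e \near to0 nu, forall p, [set (x, u, v)] p ->
    Delta_defined U W dil e p.1.1 p.1.2 p.2.
  apply: filterS (near_to0_lt nu e00) => e ee0 _ ->; split => //=.
  by apply: xW => //; rewrite nu_gt0.
have := LP _ (@compact_set1 _ (x, u, v)) Def.
rewrite uniform_set1 => DL.
have {}DL : Delta dil e x u v @[e --> to0 nu] --> L (x, u, v) by exact: DL.
by rewrite /inf_translation (cvg_lim (@metric_hausdorff _ _) DL).
Qed.

Lemma near_Delta_cball (x u v : X) : cball x A u -> cball x A v ->
  dx x u v < 1 ->
  \forall e \near to0 nu, cball (dil e x u) A (Delta dil e x u v).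
Proof.
move=> xu xv uv1; apply: filterS (near_DeltaK xu xv uv1) => e [+ _].
exact: ball_cball.
Qed.

(** The closed condition [mdist (dil e x u) (Delta dil e x u v) <= A] passes to the limit, the
    centre [dil e x u] tending to [x]. This keeps the limit in the region where [dx x] is
    meaningful. *)
Lemma cball_inf_translation (x u v l : X) : cball x A u -> cball x A v ->
  dx x u v < 1 -> Delta dil e x u v @[e --> to0 nu] --> l -> cball x A l.
Proof.
move=> xu xv uv1 Dl.
have yx := ax1_lim0 ax1 (ax0_cball ax0 xu).
apply: (closed_cvg _ (@closed_le _ A) _ _ (mdist_cvg yx Dl)).
exact: near_Delta_cball.
Qed.

Lemma dx_Delta_cvg (x u v w : X) :
  cball x A u -> cball x A v -> cball x A w -> dx x u v < 1 -> dx x u w < 1 ->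
  dx (dil e x u) (Delta dil e x u v) (Delta dil e x u w) @[e --> to0 nu] -->
  dx x v w.
Proof.
move=> xu xv xw uv1 uw1; apply/cvgrPdist_lt => eta eta0.
have eta2 : 0 < eta / 2 by rewrite divr_gt0.
have [K xK cK] := compact_nbhs x.
have Ky := ax1_lim0 ax1 (ax0_cball ax0 xu) xK.
have dK := near_dx cK eta2.
have dvw := @cvgr_dist_lt _ _ _ _ to0P _ _ (rescaled_dist_cvg xv xw) _ eta2.
have DvK := near_DeltaK xu xv uv1.
have DwK := near_DeltaK xu xw uw1.
near=> e.
have [/ball_cball yv Dv] : ball (dil e x u) A (Delta dil e x u v) /\
    dil e (dil e x u) (Delta dil e x u v) = dil e x v by near: e.
have [/ball_cball yw Dw] : ball (dil e x u) A (Delta dil e x u w) /\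
    dil e (dil e x u) (Delta dil e x u w) = dil e x w by near: e.
have Ke : K (dil e x u) by near: e.
have : `|(nu e)^-1 * mdist (dil e (dil e x u) (Delta dil e x u v))
    (dil e (dil e x u) (Delta dil e x u w)) -
    dx (dil e x u) (Delta dil e x u v) (Delta dil e x u w)| <= eta / 2.
  by move: Ke yv yw; near: e; apply: filterS dK => e dK; exact: dK.
have : `|dx x v w - (nu e)^-1 * mdist (dil e x v) (dil e x w)| < eta / 2.
  by near: e.
(* After [Dv] and [Dw] both estimates involve the same rescaled distance, and their errors add up to
   less than [eta]. *)
rewrite Dv Dw !ltr_norml !ler_norml; lra.
Unshelve. all: by end_near. Qed.

End dilatation_structure.

Theorem theorem8 (R : realType) (G : hausdorffCommTopGroupType)
  (X : completeMetricType R) (nu : G -> R) (A B : R)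
  (U : X -> set X) (V W : G -> X -> set X)
  (dil : G -> X -> X -> X) (dx : X -> X -> X -> R)
  (Hdil : dilatation_structure nu U V W dil dx A B) (x : X) :
  exists2 r : R, (0 < r)%R & forall u v w : X,
    ball x r u -> ball x r v -> ball x r w ->
    dx x (inf_translation nu dil x u v) (inf_translation nu dil x u w) =
    dx x v w.
Proof.
have nuF := to0_proper_filter (dil_scale Hdil).
have subU := ax0_cball (dil_axiom0 Hdil).
have A0 : 0 < A := lt_trans ltr01 (ax0_gt1 (dil_axiom0 Hdil)).
have [r1 r1_gt0 dx1] := dx_lt1 Hdil x.
have [r2 r2_gt0 DL] := Delta_cvg Hdil x.
(* [r1] gives [dx < 1], [r2] gives convergence of [Delta], and [A] keeps the points in the domain of
   [dx x]. *)
exists (Num.min (Num.min r1 r2) A) => [|u v w].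
  by rewrite !lt_min r1_gt0 r2_gt0.
have minP y : ball x (Num.min (Num.min r1 r2) A) y ->
    [/\ ball x r1 y, ball x r2 y & cball x A y].
  by rewrite !ballEmdist /= !lt_min => /andP[/andP[? ?] /ltW].
move=> /minP[xu1 xu2 xu] /minP[xv1 xv2 xv] /minP[xw1 xw2 xw].
have uv1 := dx1 _ _ xu1 xv1; have uw1 := dx1 _ _ xu1 xw1.
have Lv := DL _ _ xu2 xv2; have Lw := DL _ _ xu2 xw2.
(* The same real-valued family also tends to the left-hand side by continuity of [dx]; the two
   limits must agree. *)
apply: (cvg_unique _ _ (dx_Delta_cvg Hdil xu xv xw uv1 uw1)).
  exact: Rhausdorff.
apply: (dx_cvg Hdil) => //.
- exact: (ax1_lim0 (dil_axiom1 Hdil) (subU _ _ xu)).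
- exact: (cball_inf_translation Hdil xu xv uv1 Lv).
- exact: (cball_inf_translation Hdil xu xw uw1 Lw).
- by apply: filterI; apply: (near_Delta_cball Hdil).
Qed.
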